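(* Let $f,g:\mathbb{R}^{N}\rightarrow [0,\infty ]$ be Borel measurable and let $\phi$ be a Young function. Then $\phi(f)$, $\phi(g)$ and $\phi(f\barwedge g)$ are measurable and nonnegative, and $$\|f\barwedge g\|_{\phi }\leq 2^{N-1}(\|\hat{f}\|_{\phi }+\|\hat{g}\|_{\phi }).$$
   Context: $(f\barwedge g)(x):=\sup_{y\in\mathbb{R}^N}\min\{f(x-y),g(y)\}$. A Young function is a nonconstant $\phi:[0,\infty]\to[0,\infty]$ with $\phi(0)=0$, nondecreasing, convex and left continuous; $\|h\|_{\phi}:=\inf\{r>0:\int_{\mathbb{R}^N}\phi(r^{-1}|h|)\le 1\}$ ($=\infty$ if no such $r$). Enclosing balls: for nonempty bounded $X\subset\mathbb{R}^N$, $\overline{B}_X$ is the unique closed ball of minimal diameter containing $X$; $\overline{B}_X:=\mathbb{R}^N$ if $X$ is unbounded; $\overline{B}_\emptyset:=\{0\}$. For $f:\mathbb{R}^N\to[-\infty,\infty]$ and $\xi\in[-\infty,\infty]$, $\rho^+_f(\xi)\in[0,\infty]$ is the radius of $\overline{B}_{\{f>\xi\}}$, $\gamma^+_f(t):=\inf\{\xi:\rho^+_f(\xi)\le t\}$ for $t\in[0,\infty)$, and $\hat f(x):=\gamma^+_f(|x|)$ (a measurable function). Measurability means Lebesgue measurability. *)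

(* Defs.v *)
From HB Require Import structures.
From mathcomp Require Import all_boot all_order all_algebra.
From mathcomp Require Import all_classical all_reals all_analysis.
From mathcomp Require Import measurable_realfun.
Import Order.TTheory GRing.Theory Num.Theory.

Set Implicit Arguments.
Unset Strict Implicit.
Unset Printing Implicit Defensive.

Local Open Scope classical_set_scope.
Local Open Scope ring_scope.

(** * Euclidean space R^N, modelled as N-tuples of reals (RN R N).
    Its canonical measurable structure (from mathcomp-analysis) is the
    product sigma-algebra of the Borel sets of R, i.e. the Borel
    sigma-algebra of R^N. *)

Definition RN (R : realType) (N : nat) := N.-tuple R.
HB.instance Definition _ (R : realType) N := Measurable.on (RN R N).
HB.instance Definition _ (R : realType) N :=
  isPointed.Build (RN R N) [tuple (0%R : R) | _ < N].

Section Geometry.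
Variables (R : realType) (N : nat).

Definition tsub (x y : RN R N) : RN R N :=
  [tuple tnth x i - tnth y i | i < N].

Definition enorm (x : RN R N) : R :=
  Num.sqrt (\sum_(i < N) tnth x i ^+ 2).

Definition cball (c : RN R N) (r : R) : set (RN R N) :=
  [set x | enorm (tsub x c) <= r].

(* Radius of the (closed) enclosing ball of X:
   - X nonempty bounded: radius of the minimal ball containing X
     (= least radius of a closed ball containing X, which is attained);
   - X unbounded: +oo (the enclosing "ball" is R^N);
   - X empty: 0 (the enclosing ball is {0}). *)
Definition enc_radius (X : set (RN R N)) : \bar R :=
  ereal_inf [set r%:E | r in [set r : R | 0 <= r /\ exists c, X `<=` cball c r]].

End Geometry.

Local Open Scope ereal_scope.

Section Rho.
Variables (R : realType) (N : nat).
Implicit Types (f : RN R N -> \bar R).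

Definition rho_plus f (xi : \bar R) : \bar R := enc_radius [set x | xi < f x].

Definition gamma_plus f (t : R) : \bar R :=
  ereal_inf [set xi : \bar R | rho_plus f xi <= t%:E].

Definition fhat f (x : RN R N) : \bar R := gamma_plus f (enorm x).

Definition supmin f (g : RN R N -> \bar R) (x : RN R N) : \bar R :=
  ereal_sup (range (fun y => mine (f (tsub x y)) (g y))).

End Rho.

(** * Young functions phi : [0,oo] -> [0,oo] (represented on \bar R, only the
    values on [0,+oo] matter). *)
Definition young (R : realType) (phi : \bar R -> \bar R) : Prop :=
  (phi 0 = 0 /\ (forall t, 0 <= t -> 0 <= phi t)) /\
  [/\
      (exists t, 0 <= t /\ phi t <> 0),
      (forall s t, 0 <= s -> s <= t -> phi s <= phi t),
      (forall a b (l : R), 0 <= a -> 0 <= b -> (0 < l < 1)%R ->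
         phi (l%:E * a + (1 - l)%:E * b) <= l%:E * phi a + (1 - l)%:E * phi b)
    &
      (forall t : R, (0 < t)%R -> phi s%:E @[s --> t^'-] --> phi t%:E)
      /\ phi s%:E @[s --> +oo%R] --> phi +oo ].

Section Lebesgue.
Variables (R : realType) (N : nat).

Definition box (a b : RN R N) : set (RN R N) :=
  [set x | forall i, (tnth a i <= tnth x i < tnth b i)%R].

(* elementary volume: vol(A) = prod_i (b_i - a_i) if A is the box [a,b)
   with a <= b, 0 for the empty set, and +oo for any other set *)
Definition boxvol (A : set (RN R N)) : \bar R :=
  ereal_inf ([set v | A = set0 /\ v = 0] `|`
    [set v | exists a b : RN R N, (forall i, tnth a i <= tnth b i)%R
       /\ A = box a b /\ v = (\prod_(i < N) (tnth b i - tnth a i))%:E]).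

Lemma boxvol_ge0 A : 0 <= boxvol A.
Proof.
apply: le_ereal_inf_tmp => _ [[_ ->] //| [a [b [ab [_ ->]]]]].
rewrite lee_fin; apply: prodr_ge0 => i _; rewrite subr_ge0; exact: ab.
Qed.

Lemma boxvol0 : boxvol set0 = 0.
Proof.
apply/eqP; rewrite eq_le boxvol_ge0 andbT.
by apply: ereal_inf_lbound; left.
Qed.

Definition leb_outer : set (RN R N) -> \bar R := mu_ext boxvol.

HB.instance Definition _ := isOuterMeasure.Build R (RN R N) leb_outer
  (mu_ext0 boxvol0 boxvol_ge0) (mu_ext_ge0 boxvol_ge0) (le_mu_ext boxvol)
  (mu_ext_sigma_subadditive boxvol_ge0).

Definition LebRN := caratheodory_type leb_outer.

Definition lebN : set LebRN -> \bar R := leb_outer.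

HB.instance Definition _ := isMeasure.Build _ LebRN R lebN
  (@caratheodory_measure0 R (RN R N) leb_outer)
  (@caratheodory_measure_ge0 R (RN R N) leb_outer)
  (@caratheodory_measure_sigma_additive R (RN R N) leb_outer).

End Lebesgue.

Definition lux_norm (R : realType) (N : nat) (phi : \bar R -> \bar R)
    (h : RN R N -> \bar R) : \bar R :=
  ereal_inf [set r%:E | r in [set r : R | (0 < r)%R /\
    \int[@lebN R N]_(x in [set: LebRN R N]) phi (r^-1%:E * `|h x|) <= 1]].

(* Main.v *)
(* The superlevel set {f /\ g > xi} is the Minkowski sum of {f > xi} and
   {g > xi}.
   Measurability: the sum of two Borel sets is analytic, i.e. the projection of
   a closed subset of R^N x R^nat, and analytic sets are Caratheodory measurable
   because the Lebesgue outer measure is regular.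
   Inequality: the sum of sets enclosed in balls of radii a and b lies in a ball
   of radius a + b, so its measure is at most
   w (a + b)^N <= 2^(N-1) (w a^N + w b^N), where w is the measure of the unit
   ball.  As {fhat > xi} contains the open ball of radius rho_f(xi') for every
   xi' > xi, letting xi' decrease to xi bounds the distribution function of
   f /\ g by 2^(N-1) times the sum of those of fhat and ghat; left continuity of
   phi makes {phi > t} a ray, so the same bound holds after composing with phi,
   hence for integrals.  Convexity of phi with phi(0) = 0 then moves the constant
   2^(N-1) out of the Luxemburg norm. *)

Require Import Defs.
From HB Require Import structures.
From mathcomp Require Import all_boot all_order all_algebra.
From mathcomp Require Import all_classical all_reals all_analysis.
From mathcomp Require Import measurable_realfun.
From mathcomp Require Import ring lra.
Set Implicit Arguments.
Unset Strict Implicit.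
Unset Printing Implicit Defensive.
Import Order.TTheory GRing.Theory Num.Theory.
Import numFieldNormedType.Exports.
Local Open Scope classical_set_scope.
Local Open Scope ring_scope.
Local Open Scope ereal_scope.

(** * Regular outer measures *)

Lemma ereal_dense (R : realFieldType) (x y : \bar R) :
  x < y -> exists2 z, x < z & z < y.
Proof.
case: x => [x||]; case: y => [y||] //.
- rewrite lte_fin => xy; exists ((x + y) / 2)%:E; rewrite lte_fin; lra.
- by move=> _; exists (x + 1)%:E; rewrite ?ltry// lte_fin ltrDl.
- by move=> _; exists (y - 1)%:E; rewrite ?ltNyr// lte_fin gtrBl.
- by move=> _; exists 0; rewrite ?ltNy0 ?lt0y.
Qed.

Section regular_outer_measure.
Context (R : realType) (T : pointedType) (mu : {outer_measure set T -> \bar R}).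

Hypothesis mu_regular :
  forall A, exists B, [/\ caratheodory_measurable mu B, A `<=` B & mu B = mu A].

(** Continuity from below, for sets that need not be measurable. The intersections [C n] of the
    hulls of [A m] for [m >= n] are measurable, increase with [n] and have the outer measure of
    [A n], so continuity of the Caratheodory measure applies to them. *)
Lemma lt_outer_bigcup (A : nat -> set T) (c : \bar R) :
  (forall n, A n `<=` A n.+1) -> c < mu (\bigcup_n A n) ->
  exists n, c < mu (A n).
Proof.
move=> Ainc.
have Amono n m : (n <= m)%N -> A n `<=` A m.
  move/subnK <-; elim: (m - n)%N => [|k ih]; first by [].
  by rewrite addSn; apply: subset_trans ih (Ainc _).
have [B HB] := choice (fun n => mu_regular (A n)).
pose C n := \bigcap_(m in [set m | (n <= m)%N]) B m.
have mB n : measurable (B n : set (caratheodory_type mu)) by case: (HB n).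
have mC n : measurable (C n : set (caratheodory_type mu)).
  by apply: bigcap_measurable => [|m _]; [exists n => /=|exact: mB].
have AC n : A n `<=` C n.
  by move=> x Anx m /= nm; case: (HB m) => _ AB _; apply/AB/(Amono _ _ nm).
have CA n : mu (C n) <= mu (A n).
  have [_ _ <-] := HB n; apply: le_outer_measure => x; apply => /=.
  exact: leqnn.
have Cinc : nondecreasing_seq C.
  move=> n m nm; apply/subsetPset => x Cx k /= mk.
  by apply: Cx => /=; exact: leq_trans mk.
have cvC := @nondecreasing_cvg_mu _ (caratheodory_type mu) R mu C mC
  (bigcupT_measurable _ mC) Cinc.
move=> cA; have /lt_le_trans /(_ _) cC := cA.
have {}cC : c < mu (\bigcup_n C n).
  by apply: cC; apply: le_outer_measure; apply: subset_bigcup => n _; exact: AC.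
have [n cn] : exists n, c < mu (C n).
  apply: contrapT => /forallNP nC.
  suff : mu (\bigcup_n C n) <= c by rewrite leNgt cC.
  rewrite -(cvg_lim _ cvC)//; apply: lime_le; first by apply/cvg_ex; eexists; exact: cvC.
  by near=> n; rewrite leNgt /=; apply/negP/nC.
by exists n; exact: lt_le_trans (CA n).
Unshelve. all: by end_near. Qed.

(* Cut down [E [::]] coordinate by coordinate, keeping the outer measure above a
   fixed [c]; the decreasing measurable sets [K] along the resulting sequence
   intersect inside [E [::]]. *)
Lemma suslin_caratheodory (E K : seq nat -> set T) :
  (forall s m, E (rcons s m) `<=` E (rcons s m.+1)) ->
  (forall s, E s = \bigcup_m E (rcons s m)) ->
  (forall s, caratheodory_measurable mu (K s)) ->
  (forall s, E s `<=` K s) ->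
  (forall n : nat -> nat, \bigcap_k K (mkseq n k) `<=` E [::]) ->
  caratheodory_measurable mu (E [::]).
Proof.
move=> Einc Ecup mK EK KE; apply: le_caratheodory_measurable => X.
(* Only values strictly below the outer measure can be kept along a branch; letting [c] increase at
   the end recovers the Caratheodory inequality. *)
have main c : c < mu (X `&` E [::]) -> c + mu (X `&` ~` E [::]) <= mu X.
  move=> cE.
  have [m Hm] : {m : seq nat -> nat & forall s, c < mu (X `&` E s) ->
      c < mu (X `&` E (rcons s (m s)))}.
    apply: (@choice _ _ (fun s m => c < mu (X `&` E s) ->
      c < mu (X `&` E (rcons s m)))) => s.
    have [cs|] := pselect (c < mu (X `&` E s)); last by exists 0%N.
    have [k||k ck] := @lt_outer_bigcup (fun k => X `&` E (rcons s k)) c.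
    - by apply: setIS; exact: Einc.
    - by rewrite -setI_bigcupr -Ecup.
    - by exists k.
  pose s := fix s k := if k is k'.+1 then rcons (s k') (m (s k')) else [::].
  pose n k := m (s k).
  have sE k : s k = mkseq n k.
    by elim: k => [//|k ih]; rewrite /= {1}ih /mkseq -addn1 iotaD map_cat cats1.
  have cs k : c < mu (X `&` E (s k)) by elim: k => [|k ih] /=; last exact: Hm.
  pose L k := \bigcap_(j in [set j | (j <= k)%N]) K (s j).
  have mL k : caratheodory_measurable mu (L k).
    have : measurable (L k : set (caratheodory_type mu)) ; last by [].
    by apply: bigcap_measurable => [|j _]; [exists 0%N|exact: mK].
  have EL k : E (s k) `<=` L k.
    move=> x Ex j /= jk; apply: EK.
    move: Ex; rewrite -(subnK jk); elim: (k - j)%N => [//|i ih].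
    by rewrite addSn /= => Ex; apply: ih; rewrite Ecup; exists (m (s (i + j)%N)).
  have LE : \bigcap_k L k `<=` E [::].
    move=> x Lx; apply: (KE n) => k _; rewrite -sE.
    by apply: (Lx k) => //=; exact: leqnn.
  have bnd k : c + mu (X `&` ~` L k) <= mu X.
    rewrite (mL k X); apply: leeD2r; apply: ltW; apply: lt_le_trans (cs k) _.
    by apply: le_outer_measure; exact: setIS.
  rewrite leNgt; apply/negP => lt.
  have [mXoo|mXoo] := eqVneq (mu X) +oo; first by rewrite mXoo ltNge leey in lt.
  have c0 : c \is a fin_num \/ c = -oo.
    have := lt_trans cE (le_lt_trans (le_outer_measure mu _ _ (@subIsetl _ _ _)) _).
    move=> /(_ +oo); rewrite ltey mXoo => /(_ isT).
    by case: (c) => [r||] //; [left|right].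
  case: c0 => [cfin|cNy]; last by rewrite cNy addNye ltNge leNye in lt.
  (* The complements of the [L k] increase and cover that of [E [::]], so continuity from below
     contradicts [bnd] at some [k]. *)
  have lt' : mu X - c < mu (X `&` ~` E [::]) by rewrite lteBlDl// addeC.
  have [k||k] := @lt_outer_bigcup (fun k => X `&` ~` L k) (mu X - c).
  - apply: setIS; apply: subsetC => x Lx j /= jk.
    by apply: Lx => /=; exact: leqW.
  - apply: lt_le_trans lt' _; apply: le_outer_measure.
    by rewrite -setI_bigcupr -setC_bigcap; apply: setIS; exact: subsetC.
  - by rewrite lteBlDl// ltNge bnd.
have [XEoo|XEfin] := eqVneq (mu (X `&` ~` E [::])) +oo.
  suff -> : mu X = +oo by rewrite leey.
  apply/eqP; rewrite -leye_eq -XEoo.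
  by apply: le_outer_measure; exact: subIsetl.
have XEf : mu (X `&` ~` E [::]) \is a fin_num.
  by rewrite ge0_fin_numE ?outer_measure_ge0// ltey.
rewrite -leeBrDr// leNgt; apply/negP => lt.
have [c c1 c2] := ereal_dense lt.
by have := main _ c2; rewrite -leeBrDr// leNgt c1.
Qed.

End regular_outer_measure.

(** * Lebesgue outer measure *)

Section lebesgue_outer_measure.
Context (R : realType) (N : nat).
Local Notation V := (RN R N).
Local Notation lam := (@leb_outer R N).

Lemma measurable_tnth_preimage (i : 'I_N) (B : set R) :
  measurable B -> measurable ((fun x : V => tnth x i) @^-1` B).
Proof.
move=> mB; have := measurable_tnth (T := R) i measurableT mB.
by rewrite setTI.
Qed.

Lemma boxvol_split (i : 'I_N) (a : R) (A : set V) :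
  boxvol (A `&` [set x | (tnth x i < a)%R]) +
  boxvol (A `&` ~` [set x | (tnth x i < a)%R]) <= boxvol A.
Proof.
rewrite {3}/boxvol; apply: le_ereal_inf_tmp => _ [[-> ->]|[u [v [uv [-> ->]]]]].
  by rewrite !set0I boxvol0 adde0.
(* [m] is [a] clamped to side [i] of the box, so both pieces are boxes with ordered corners even
   when the hyperplane misses the box. *)
pose m := Num.min (Num.max a (tnth u i)) (tnth v i).
pose v' : V := [tuple if j == i then m else tnth v j | j < N].
pose u' : V := [tuple if j == i then m else tnth u j | j < N].
have um : (tnth u i <= m)%R by rewrite /m le_min le_max lexx orbT uv.
have mv : (m <= tnth v i)%R by rewrite /m ge_min lexx orbT.
have E1 : box u v `&` [set x | (tnth x i < a)%R] = box u v'.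
  apply/seteqP; split => x /=.
    move=> [H xa] j; rewrite tnth_mktuple; case: eqP => [->|_]; last exact: H.
    have /andP[-> xv] := H i.
    by rewrite /m lt_min lt_max xa xv.
  move=> H; split.
    move=> j; have := H j; rewrite tnth_mktuple; case: eqP => [->|_]//.
    by move=> /andP[-> /lt_le_trans]; exact.
  have := H i; rewrite tnth_mktuple eqxx /m => /andP[ux].
  by rewrite lt_min lt_max => /andP[/orP[//|]]; rewrite ltNge ux.
have E2 : box u v `&` ~` [set x | (tnth x i < a)%R] = box u' v.
  apply/seteqP; split => x /=.
    move=> [H /negP xa] j; rewrite tnth_mktuple; case: eqP => [->|_]; last exact: H.
    have /andP[ux xv] := H i; move: xa; rewrite -leNgt => xa.
    by rewrite /m xv ge_min ge_max xa ux.
  move=> H; split.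
    move=> j; have := H j; rewrite tnth_mktuple; case: eqP => [->|_]//.
    by move=> /andP[mx ->]; rewrite (le_trans um mx).
  have := H i; rewrite tnth_mktuple eqxx /m => /andP[].
  rewrite ge_min ge_max => /orP[/andP[ax _ _]|vx xv].
    by apply/negP; rewrite -leNgt.
  by move: xv; rewrite ltNge vx.
rewrite E1 E2; apply: (@le_trans _ _ ((\prod_(j < N) (tnth v' j - tnth u j))%:E
   + (\prod_(j < N) (tnth v j - tnth u' j))%:E)).
  apply: leeD; apply: ereal_inf_lbound; right.
    exists u, v'; split => // j; rewrite tnth_mktuple.
    by case: eqP => [->|].
  exists u', v; split => // j; rewrite tnth_mktuple.
  by case: eqP => [->|].
rewrite -EFinD lee_fin (bigD1 i)//= [X in (_ + X)%R](bigD1 i)//=.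
rewrite [X in (_ <= X)%R](bigD1 i)//= !tnth_mktuple eqxx.
rewrite (eq_bigr (fun j => tnth v j - tnth u j)%R); last first.
  by move=> j /negPf ji; rewrite tnth_mktuple ji.
rewrite [X in (_ + _ * X)%R](eq_bigr (fun j => tnth v j - tnth u j)%R); last first.
  by move=> j /negPf ji; rewrite tnth_mktuple ji.
by rewrite -mulrDl; rewrite addrC subrKA.
Qed.

(** Cutting each set of a cover along the hyperplane gives covers of the two parts of [X], and
    [boxvol_split] adds up term by term. *)
Lemma halfspace_caratheodory (i : 'I_N) (a : R) :
  caratheodory_measurable lam [set x | (tnth x i < a)%R].
Proof.
set H := [set x | _].
have mH : measurable (H : set V).
  rewrite (_ : H = (fun x : V => tnth x i) @^-1` `]-oo, a[%classic).
    apply: measurable_tnth_preimage.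
    exact: measurable_itv.
  by apply/seteqP; split => x /=; rewrite in_itv.
apply: le_caratheodory_measurable => X.
rewrite -[leRHS]/(mu_ext (@boxvol R N) X); apply: le_ereal_inf_tmp => _ [F [mF XF] <-].
apply: (@le_trans _ _ (\sum_(k <oo) boxvol (F k `&` H) + \sum_(k <oo) boxvol (F k `&` ~` H))).
  apply: leeD; apply: ereal_inf_lbound.
    exists (fun k => F k `&` H) => //; split => [k|]; first exact: measurableI.
    by rewrite -setI_bigcupl; exact: setSI.
  exists (fun k => F k `&` ~` H) => //; split => [k|].
    by apply: measurableI => //; exact: measurableC.
  by rewrite -setI_bigcupl; exact: setSI.
rewrite -nneseriesD; try by move=> *; exact: boxvol_ge0.
by apply: lee_nneseries => k _ *; [apply: adde_ge0; exact: boxvol_ge0|exact: boxvol_split].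
Qed.

(** Induction over Borel sets from half-spaces as generators. It serves once for Caratheodory
    measurability and once for analyticity. *)
Lemma RN_measurable_ind (P : set (set V)) : sigma_algebra setT P ->
  (forall i a, P [set x | (tnth x i < a)%R]) ->
  forall A, measurable A -> P A.
Proof.
move=> sP Phalf A; rewrite /measurable/= /g_sigma_preimage; apply.
split=> //; apply: (big_ind (fun X => X `<=` P)) => [//|X Y XP YP|i _].
  by rewrite subUset.
move=> _ [B mB <-]; rewrite setTI.
have := mB; rewrite [X in X B -> _](RGenInftyO.measurableE R).
have [P0 PC PU] := sP.
apply: (@smallest_sub _ _ _ [set B | P ((fun x : V => tnth x i) @^-1` B)]).
- split => /=; first by rewrite preimage_set0.
  + by move=> D PD; rewrite setTD preimage_setC -setTD; exact: PC.
  + by move=> F PF; rewrite preimage_bigcup; exact: PU.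
- by move=> _ [a ->] /=; have := Phalf i a; congr P.
Qed.

Lemma borel_caratheodory (A : set V) :
  measurable A -> caratheodory_measurable lam A.
Proof.
apply: RN_measurable_ind; last exact: halfspace_caratheodory.
by have := sigma_algebra_measurable (caratheodory_type lam).
Qed.

(** The hull is the intersection over [n] of the unions of covers whose total volume exceeds [lam A]
    by less than [1 / (n + 1)]; when [lam A] is infinite the whole space serves. *)
Lemma leb_outer_regular (A : set V) :
  exists B, [/\ caratheodory_measurable lam B, A `<=` B & lam B = lam A].
Proof.
have [Aoo|Afin] := eqVneq (lam A) +oo.
  exists setT; split => //.
    by have : measurable (setT : set (caratheodory_type lam)) by [].
  by apply/eqP; rewrite Aoo -leye_eq -Aoo; exact: (@le_outer_measure _ _ lam).
have [F HF] : {F : nat -> nat -> set V & forall n, measurable_cover A (F n) /\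
    \sum_(k <oo) boxvol (F n k) < lam A + n.+1%:R^-1%:E}.
  apply: (@choice _ _ (fun n F => measurable_cover A F /\
    \sum_(k <oo) boxvol (F k) < lam A + n.+1%:R^-1%:E)) => n.
  have Af : lam A \is a fin_num by rewrite ge0_fin_numE ?outer_measure_ge0// ltey.
  have /(lb_ereal_inf_adherent (e := n.+1%:R^-1)) := Af.
  rewrite invr_gt0 ltr0n => /(_ isT)[_ [G AG <-] lt].
  by exists G.
pose B := \bigcap_n \bigcup_k F n k.
have mF n k : measurable (F n k) by case: (HF n) => -[].
have AB : A `<=` B by move=> x Ax n _; case: (HF n) => -[_ /(_ _ Ax)].
exists B; split => //.
  by apply: borel_caratheodory; apply: bigcapT_measurable => n; exact: bigcupT_measurable.
apply/eqP; rewrite eq_le (le_outer_measure lam _ _ AB) andbT.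
apply/lee_addgt0Pr => e e0.
have [n _ ne] := (near_infty_natSinv_lt (PosNum e0)).
have := ne n (leqnn n) => /= {}ne.
apply: (@le_trans _ _ (lam (\bigcup_k F n k))).
  by apply: (le_outer_measure lam) => x; exact.
apply: (@le_trans _ _ (\sum_(k <oo) boxvol (F n k))).
  by apply: ereal_inf_lbound; exists (F n) => //; split.
by apply: (le_trans (ltW (HF n).2)); apply: leeD2l; rewrite lee_fin ltW.
Qed.

End lebesgue_outer_measure.

(** * Analytic sets *)

Definition minkowski_sum (R : realType) (N : nat) (A B : set (RN R N)) : set (RN R N) :=
  [set z | exists2 y, A (tsub z y) & B y].

Section analytic_sets.
Context (R : realType) (N : nat).
Local Notation V := (RN R N).
Local Notation seqR := (nat -> R).
Implicit Types (P : set seqR) (A B : set V).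

(* Closedness for the product topology, phrased with ultrafilters on the index
   set of the sequences. *)
Definition ptclosed P := forall (F : set_system nat) (u : nat -> seqR) (y : seqR),
  UltraFilter F -> F [set n | P (u n)] ->
  (forall k, (fun n => u n k) @ F --> y k) -> P y.

Definition ptcontinuous (h : seqR -> R) :=
  forall (F : set_system nat) (u : nat -> seqR) (y : seqR),
  ProperFilter F -> (forall k, (fun n => u n k) @ F --> y k) ->
  (fun n => h (u n)) @ F --> h y.

Lemma ptcontinuous_coord (k : nat) : ptcontinuous (fun y => y k).
Proof. by move=> F u y _; exact. Qed.

Lemma ptcontinuous_cst (a : R) : ptcontinuous (fun=> a).
Proof. by move=> F u y FF _; exact: cvg_cst. Qed.

Lemma ptcontinuousD h k : ptcontinuous h -> ptcontinuous k ->
  ptcontinuous (fun y => h y + k y)%R.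
Proof. by move=> ch ck F u y FF uy; apply: cvgD; [exact: ch|exact: ck]. Qed.

Lemma ptcontinuousB h k : ptcontinuous h -> ptcontinuous k ->
  ptcontinuous (fun y => h y - k y)%R.
Proof. by move=> ch ck F u y FF uy; apply: cvgB; [exact: ch|exact: ck]. Qed.

Lemma ptcontinuousM h k : ptcontinuous h -> ptcontinuous k ->
  ptcontinuous (fun y => h y * k y)%R.
Proof. by move=> ch ck F u y FF uy; apply: cvgM; [exact: ch|exact: ck]. Qed.

Lemma ptcontinuous_norm h : ptcontinuous h -> ptcontinuous (fun y => `|h y|)%R.
Proof. by move=> ch F u y FF uy; apply: cvg_norm; exact: ch. Qed.

Lemma ptclosed_reindex (e : nat -> nat) P :
  ptclosed P -> ptclosed [set y | P (fun k => y (e k))].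
Proof. by move=> cP F u y UF FP uy; exact: (cP F (fun n k => u n (e k))). Qed.

Lemma ptclosed_le (h k : seqR -> R) : ptcontinuous h -> ptcontinuous k ->
  ptclosed [set y | (h y <= k y)%R].
Proof.
move=> ch ck F u y UF FP uy /=; have PF : ProperFilter F by exact: ultra_proper.
by apply: (ler_cvg_to (ch F u y PF uy) (ck F u y PF uy) FP).
Qed.

Lemma ptclosed_eq (h k : seqR -> R) : ptcontinuous h -> ptcontinuous k ->
  ptclosed [set y | h y = k y].
Proof.
move=> ch ck F u y UF FP uy /=; have PF : ProperFilter F by exact: ultra_proper.
by apply/eqP; rewrite eq_le; apply/andP; split;
  [apply: (@ptclosed_le h k ch ck F u) => //|apply: (@ptclosed_le k h ck ch F u) => //];
  apply: filterS FP => n /= ->.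
Qed.

Lemma ptclosed_forall I (P : I -> set seqR) :
  (forall i, ptclosed (P i)) -> ptclosed [set y | forall i, P i y].
Proof.
move=> cP F u y UF FP uy i; apply: (cP i F u) => //.
by apply: filterS FP => n; exact.
Qed.

Lemma ptclosedI P (Q : set seqR) :
  ptclosed P -> ptclosed Q -> ptclosed [set y | P y /\ Q y].
Proof.
by move=> cP cQ F u y UF FP uy; split;
  [apply: (cP F u)|apply: (cQ F u)] => //; apply: filterS FP => n [].
Qed.

Lemma ptclosedU P (Q : set seqR) :
  ptclosed P -> ptclosed Q -> ptclosed [set y | P y \/ Q y].
Proof.
move=> cP cQ F u y UF FPQ uy.
(* An ultrafilter contains this index set or its complement, which selects one of the two closed
   sets for the limit. *)
have [FP|FP] := in_ultra_setVsetC [set n | P (u n)] UF.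
  by left; exact: (cP F u).
right; apply: (cQ F u) => //.
by apply: filterS2 FP FPQ => n /= nP [].
Qed.

(* [A] is a projection of a closed subset of R^nat; the coordinates of the point
   of [A] are read off at the positions [c]. *)
Definition analytic A := exists (P : set seqR) (c : 'I_N -> nat),
  ptclosed P /\ forall x, A x <-> exists2 y, P y & forall i, y (c i) = tnth x i.

(** The rows of an infinite matrix are coded into one sequence, so that countably many witnesses fit
    into a single point of R^nat. *)
Lemma merge_sequences (ys : nat -> nat -> R) :
  exists y : seqR, forall i k, y (pickle (i, k)) = ys i k.
Proof.
exists (fun m => if @unpickle (nat * nat)%type m is Some (i, k) then ys i k else 0%R).
by move=> i k; rewrite pickleK.
Qed.

Definition coord_ext (x : V) (k : nat) : R :=
  if insub k is Some i then tnth x i else 0%R.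

Lemma coord_extE x (i : 'I_N) : coord_ext x i = tnth x i.
Proof. by rewrite /coord_ext valK. Qed.

Lemma analytic_set0 : analytic set0.
Proof.
exists set0, (fun=> 0%N); split; first by move=> F u y UF FP; have [n] := filter_ex FP.
by move=> x; split => // -[].
Qed.

Lemma analytic_setT : analytic setT.
Proof.
exists setT, (fun i => i : nat); split; first by [].
by move=> x; split => // _; exists (coord_ext x) => // i; rewrite coord_extE.
Qed.

Lemma analytic_ge (i : 'I_N) (a : R) : analytic [set x | (a <= tnth x i)%R].
Proof.
exists [set y | (a <= y i)%R], (fun i => i : nat); split.
  by apply: ptclosed_le; [exact: ptcontinuous_cst|exact: ptcontinuous_coord].
move=> x; split => /= [ax|[y ay <-]//].
by exists (coord_ext x) => [|j]; rewrite /= coord_extE.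
Qed.

(** An extra coordinate turns the strict inequality into a closed condition: position [N], free
    since [x] occupies those below, holds the inverse of [a - x_i]. *)
Lemma analytic_lt (i : 'I_N) (a : R) : analytic [set x | (tnth x i < a)%R].
Proof.
exists [set y | (0 <= y N)%R /\ ((a - y i) * y N = 1)%R], (fun i => i : nat); split.
  apply: ptclosedI.
    by apply: ptclosed_le; [exact: ptcontinuous_cst|exact: ptcontinuous_coord].
  apply: ptclosed_eq; last exact: ptcontinuous_cst.
  apply: ptcontinuousM; last exact: ptcontinuous_coord.
  by apply: ptcontinuousB; [exact: ptcontinuous_cst|exact: ptcontinuous_coord].
move=> x; split => /= [xa|[y [y0 yN] <-]].
  have ax : (0 < a - tnth x i)%R by rewrite subr_gt0.
  exists (fun k => if k == N then (a - tnth x i)^-1%R else coord_ext x k) => [|j] /=.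
    rewrite eqxx (ltn_eqF (ltn_ord i)) coord_extE invr_ge0 ltW//; split => //.
    by rewrite divff// gt_eqF.
  by rewrite (ltn_eqF (ltn_ord j)) coord_extE.
rewrite -subr_gt0 ltNge; apply/negP => ay.
by have := mulr_le0_ge0 ay y0; rewrite yN ler10.
Qed.

(** Row [n + 1] of the sequence holds a witness for [F n] and row 0 the point itself; closed
    equations force all witnesses to project to that point. *)
Lemma analytic_bigcap (F : nat -> set V) :
  (forall n, analytic (F n)) -> analytic (\bigcap_n F n).
Proof.
move=> aF; have [P HP] := choice aF; have [c {}HP] := choice HP.
pose e n (y : seqR) : seqR := fun k => y (pickle (n.+1, k)).
exists [set y | forall n, P n (e n y) /\
  forall i, y (pickle (n.+1, c n i)) = y (pickle (0, val i))%N],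
  (fun i => pickle (0%N, val i)); split.
  apply: ptclosed_forall => n.
  apply: ptclosedI; first by apply: ptclosed_reindex; case: (HP n).
  by apply: ptclosed_forall => i; apply: ptclosed_eq; exact: ptcontinuous_coord.
move=> x; split => [Fx|[y Py yx] n _].
  have /choice[ys Hys] n : exists y, P n y /\ forall i, y (c n i) = tnth x i.
    have [_ /(_ x)[+ _]] := HP n.
    by move=> /(_ (Fx n Logic.I))[y Py yc]; exists y.
  have [y Hy] := merge_sequences (fun n => if n is n'.+1 then ys n' else coord_ext x).
  exists y => [n|i]; last by rewrite Hy coord_extE.
  have [Pn yc] := Hys n; split => [|i]; last by rewrite !Hy yc coord_extE.
  by rewrite (_ : e n y = ys n)//; apply/funext => k; rewrite /e Hy.
have [_ ->] := HP n; have [Pn yc] := Py n.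
by exists (e n y) => // i; rewrite /e yc yx.
Qed.

Lemma analytic_bigcup (F : nat -> set V) :
  (forall n, analytic (F n)) -> analytic (\bigcup_n F n).
Proof.
move=> aF; have [P HP] := choice aF; have [c {}HP] := choice HP.
pose e (y : seqR) : seqR := fun k => y (pickle (1%N, k)).
pose p (k : nat) : nat := pickle (2%N, k).
pose t (y : seqR) : R := y (pickle (0%N, 0%N)).
(* The coordinate [t] selects the member of the union; since it ranges over all
   nonnegative reals, every integer closer than 1 to it is required to work. *)
pose Q n := [set y : seqR | (1 <= `|t y - n%:R|)%R \/
  (P n (e y) /\ forall i : 'I_N, y (pickle (1%N, c n i)) = y (p i))].
exists [set y | (0 <= t y)%R /\ forall n, Q n y], (fun i => p i); split.
  apply: ptclosedI.
    by apply: ptclosed_le; [exact: ptcontinuous_cst|exact: ptcontinuous_coord].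
  apply: ptclosed_forall => n; apply: ptclosedU.
    apply: ptclosed_le; first exact: ptcontinuous_cst.
    apply: ptcontinuous_norm.
    by apply: ptcontinuousB; [exact: ptcontinuous_coord|exact: ptcontinuous_cst].
  apply: ptclosedI; first by apply: ptclosed_reindex; case: (HP n).
  by apply: ptclosed_forall => i; apply: ptclosed_eq; exact: ptcontinuous_coord.
move=> x; split => [[n _ Fx]|[y [t0 Qy] yx]].
  have [_ /(_ x)[+ _]] := HP n => /(_ Fx)[z Pz zc].
  have [y Hy] := merge_sequences (fun m => match m with
    | 0%N => fun=> n%:R%R | 1%N => z | _ => coord_ext x end).
  exists y => [|i]; last by rewrite /p Hy coord_extE.
  split; first by rewrite /= /t Hy.
  move=> m; have [->|mn] := eqVneq m n.
    right; split => [|i]; last by rewrite /= /p !Hy zc coord_extE.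
    by rewrite /= (_ : e y = z)//; apply/funext => k; rewrite /e Hy.
  left; rewrite /= /t Hy; case: (ltngtP m n) mn => // mn _.
    by rewrite -natrB ?normr_nat ?ler1n ?subn_gt0// ltnW.
  by rewrite distrC -natrB ?normr_nat ?ler1n ?subn_gt0// ltnW.
pose n := Num.truncn (t y).
have /andP[nt tn] : (n%:R <= t y < n.+1%:R)%R by rewrite truncn_itv.
exists n => //; have [|[Pn yc]] := Qy n.
  move=> /=; rewrite ger0_norm ?subr_ge0// => h.
  by move: tn; rewrite -natr1 -ltrBlDl ltNge h.
have [_ ->] := HP n; exists (e y) => // i.
by rewrite /e yc yx.
Qed.

Lemma borel_analytic A : measurable A -> analytic A.
Proof.
(* Complements of analytic sets need not be analytic, so the induction carries each set together
   with its complement. *)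
move=> mA; suff : [set A | analytic A /\ analytic (~` A)] A by case.
move: A mA; apply: RN_measurable_ind; last first.
  move=> i a; split; first exact: analytic_lt.
  have := analytic_ge i a; congr analytic.
  by apply/seteqP; split => x /=; rewrite leNgt => /negP.
split=> /=.
- by split; [exact: analytic_set0|rewrite setC0; exact: analytic_setT].
- by move=> A [aA aCA]; rewrite setTD setCK.
- move=> F aF; split; first by apply: analytic_bigcup => n; case: (aF n).
  by rewrite setC_bigcup; apply: analytic_bigcap => n; case: (aF n).
Qed.

(** Witnesses for the two summands and the coordinates of the sum are packed into three rows, linked
    by closed linear equations. *)
Lemma analytic_sum A B : analytic A -> analytic B ->
  analytic (minkowski_sum A B).
Proof.
move=> [P [c [cP AP]]] [Q [d [cQ BQ]]].
pose e (y : seqR) : seqR := fun k => y (pickle (0%N, k)).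
pose f (y : seqR) : seqR := fun k => y (pickle (1%N, k)).
pose p (k : nat) : nat := pickle (2%N, k).
exists [set y | (P (e y) /\ Q (f y)) /\
  forall i : 'I_N, y (p i) = (e y (c i) + f y (d i))%R], (fun i => p i); split.
  apply: ptclosedI; first by apply: ptclosedI; exact: ptclosed_reindex.
  apply: ptclosed_forall => i; apply: ptclosed_eq; first exact: ptcontinuous_coord.
  by apply: ptcontinuousD; exact: ptcontinuous_coord.
move=> z; split => [[x /AP[u Pu uc] /BQ[v Qv vd]]|].
  have [y Hy] := merge_sequences (fun m => match m with
    | 0%N => u | 1%N => v | _ => coord_ext z end).
  have ey : e y = u by apply/funext => k; rewrite /e Hy.
  have fy : f y = v by apply/funext => k; rewrite /f Hy.
  exists y => [|i]; last by rewrite /p Hy coord_extE.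
  split; first by rewrite /= ey fy.
  by move=> i; rewrite ey fy uc vd /p Hy coord_extE tnth_mktuple subrK.
move=> [y [[Py Qy] yc] yz].
exists ([tuple f y (d i) | i < N] : V).
  by apply/AP; exists (e y) => // i; rewrite !tnth_mktuple -yz yc addrK.
by apply/BQ; exists (f y) => // i; rewrite tnth_mktuple.
Qed.

(** This is the union of the cells of side [1 / (m + 1)] that meet [A]. There are countably many
    cells, each a Borel box, so the union is Borel whatever [A] is. *)
Lemma grid_caratheodory (m : nat) (A : set V) :
  caratheodory_measurable (@leb_outer R N) [set x | exists2 z, A z &
    forall i, Num.floor (m.+1%:R * tnth x i)%R = Num.floor (m.+1%:R * tnth z i)%R].
Proof.
apply: borel_caratheodory.
pose C (v : N.-tuple int) : set V :=
  [set x | forall i, Num.floor (m.+1%:R * tnth x i)%R = tnth v i].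
have mC v : measurable (C v).
  rewrite (_ : C v = \bigcap_(i in [set: 'I_N]) ((fun x : V => tnth x i) @^-1`
      `[((tnth v i)%:~R / m.+1%:R)%R, ((tnth v i + 1)%:~R / m.+1%:R)%R[%classic)).
    apply: fin_bigcap_measurable; first exact: finite_finset.
    by move=> i _; apply: measurable_tnth_preimage; exact: measurable_itv.
  apply/seteqP; split => x /=.
    move=> H i _ /=; rewrite in_itv/= ler_pdivrMr ?ltr0n// ltr_pdivlMr ?ltr0n//.
    by rewrite mulrC -(H i) floor_itv.
  move=> H i; apply/floor_def; have := H i Logic.I.
  by rewrite /= in_itv/= ler_pdivrMr ?ltr0n// ltr_pdivlMr ?ltr0n// mulrC.
rewrite (_ : mkset _ = \bigcup_v (if `[< exists2 z, A z & C v z >] then C v else set0)).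
  apply: countable_bigcupT_measurable => [|v]; first exact: countableP.
  by case: ifP.
apply/seteqP; split => x /=.
  move=> [z Az xz]; exists [tuple Num.floor (m.+1%:R * tnth z i)%R | i < N] => //.
  case: ifPn => [_ i|/asboolPn]; first by rewrite xz tnth_mktuple.
  by case; exists z => // i; rewrite tnth_mktuple.
move=> [v _]; case: ifPn => // /asboolP[z Az Cz] Cx.
by exists z => // i; rewrite Cx Cz.
Qed.

Lemma ultra_bounded_cvg (F : set_system nat) (u : nat -> R) (b : R) :
  UltraFilter F -> F [set n | (`|u n| <= b)%R] ->
  exists l : R, u @ F --> l.
Proof.
move=> UF Fb; have PF : ProperFilter F by exact: ultra_proper.
have UuF : UltraFilter (fmap u F).
  split=> [|G PG FG]; first exact: fmap_proper_filter.
  apply/seteqP; split => [A GA|]; last exact: FG.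
  have [//|FA] := in_ultra_setVsetC (u @^-1` A) UF.
  have GCA : G (~` A) by apply: FG.
  by have [x []] := filter_ex (filterI GA GCA).
have := @segment_compact R (- b) b; rewrite compact_ultra.
move=> /(_ (fmap u F) UuF)[|l [_ ul]]; last by exists l.
rewrite /fmap/=; apply: filterS Fb => n /=.
by rewrite ler_norml in_itv.
Qed.

(** A Suslin scheme: [E s] keeps the points with a witness whose first coordinates are bounded by
    the entries of [s], and [K s] thickens [E s] to grid cells of side [1 / (size s + 1)]. Along a
    branch the witnesses are bounded in each coordinate; they converge along an ultrafilter, and the
    limit stays in the closed set [P]. *)
Lemma analytic_caratheodory A :
  analytic A -> caratheodory_measurable (@leb_outer R N) A.
Proof.
move=> [P [c [cP AP]]].
pose E (s : seq nat) := [set x : V | exists y, [/\ P y, forall i, y (c i) = tnth x i &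
  forall j, (j < size s)%N -> (`|y j| <= (nth 0%N s j)%:R)%R]].
pose K (s : seq nat) := [set x : V | exists2 z, E s z & forall i,
  Num.floor ((size s).+1%:R * tnth x i)%R = Num.floor ((size s).+1%:R * tnth z i)%R].
have AE : A = E [::].
  apply/seteqP; split => x; first by move=> /AP[y Py yx]; exists y; split.
  by move=> [y [Py yx _]]; apply/AP; exists y.
rewrite AE; apply: (@suslin_caratheodory _ _ _ (@leb_outer_regular R N) E K).
- move=> s m x [y [Py yx ys]]; exists y; split => // j.
  rewrite size_rcons => js; apply: le_trans (ys _ _) _; rewrite ?size_rcons//.
  by rewrite !nth_rcons; case: ifP => // _; case: ifP => // _; rewrite ler_nat.
- move=> s; apply/seteqP; split => x.
    move=> [y [Py yx ys]]; exists (Num.truncn `|y (size s)|).+1 => //.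
    exists y; split => // j; rewrite size_rcons ltnS leq_eqVlt nth_rcons.
    move=> /orP[/eqP->|js]; last by rewrite js ys.
    by rewrite ltnn eqxx ltW// truncnS_gt.
  move=> [m _ [y [Py yx ys]]]; exists y; split => // j js.
  by have := ys j; rewrite size_rcons nth_rcons js; apply; exact: ltnW.
- by move=> s; exact: grid_caratheodory.
- by move=> s x Ex; exists x.
move=> n x Kx.
have /choice[z Hz] k : exists z, E (mkseq n k) z /\ forall i,
    (`|tnth z i - tnth x i| <= k.+1%:R^-1)%R.
  have [z Ez xz] := Kx k Logic.I; exists z; split => // i.
  have := xz i; rewrite size_mkseq => e.
  have := floor_itv (k.+1%:R * tnth x i)%R; rewrite e => /andP[x1 x2].
  have /andP[z1 z2] := floor_itv (k.+1%:R * tnth z i)%R.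
  rewrite -(ler_pM2l (x := k.+1%:R)) ?ltr0n// mulfV ?pnatr_eq0//.
  rewrite -[X in (X * _)%R]ger0_norm// -normrM mulrBr ler_norml.
  by move: x1 x2 z1 z2; rewrite intrD; lra.
have /choice[y Hy] k : exists y, [/\ P y, forall i, y (c i) = tnth (z k) i &
    forall j, (j < k)%N -> (`|y j| <= (n j)%:R)%R].
  have [[y [Py yz yn]] _] := Hz k; exists y; split => // j jk.
  by have := yn j; rewrite size_mkseq nth_mkseq//; exact.
(* An ultrafilter finer than [\oo] makes all coordinates of the witnesses converge at once:
   coordinate [j] is bounded by [n j] for every [k > j]. *)
have [F [UF FN]] := ultraFilterLemma (T := nat) (F := \oo) _.
have PF : ProperFilter F by exact: ultra_proper.
have /choice[l Hl] j : exists l : R, (fun k => y k j) @ F --> l.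
  apply: (@ultra_bounded_cvg _ _ (n j)%:R) => //.
  apply: FN; exists j.+1 => // k /= jk.
  by have [_ _] := Hy k; apply.
exists l; split => // [|i].
  apply: (cP F y) => //; apply: filterS filterT => k _.
  by case: (Hy k).
have xi : (fun k => y k (c i)) @ F --> (tnth x i : R).
  have : (fun k => y k (c i)) @ \oo --> (tnth x i : R).
    apply/cvgrPdist_le => e e0; near=> k.
    have [_ -> _] := Hy k; have [_ /(_ i)] := Hz k.
    rewrite distrC => /le_trans; apply; apply: ltW.
    by near: k; exact: (near_infty_natSinv_lt (PosNum e0)).
  by apply: cvg_trans; exact: cvg_app.
exact: (cvg_unique _ (Hl (c i)) xi).
Unshelve. all: by end_near. Qed.

Lemma borel_sum_caratheodory A B : measurable A -> measurable B ->
  caratheodory_measurable (@leb_outer R N) (minkowski_sum A B).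
Proof.
by move=> mA mB; apply/analytic_caratheodory/analytic_sum; exact: borel_analytic.
Qed.

End analytic_sets.

(** * Balls and enclosing radii *)

Section euclidean_geometry.
Context (R : realType) (N : nat).
Local Notation V := (RN R N).
Local Notation lam := (@leb_outer R N).
Implicit Types (x y c : V) (A B F G : set V).

(** For [r > 0] this maps the ball of centre [c] and radius [r] onto the unit ball; volumes of balls
    are compared through its preimages. *)
Definition affine (r : R) c x : V := [tuple ((tnth x i - tnth c i) / r)%R | i < N].

Lemma measurable_affine r c : measurable_fun setT (affine r c).
Proof.
apply/measurable_fun_tnthP => i.
rewrite (_ : _ \o _ = (fun x => (tnth x i - tnth c i) / r)%R).
  apply: measurable_funM => //; apply: measurable_funB => //.
  exact: measurable_tnth.
by apply/funext => x; rewrite /= tnth_mktuple.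
Qed.

Lemma boxvol_affine (r : R) c A : (0 < r)%R ->
  boxvol (affine r c @^-1` A) <= (r ^+ N)%:E * boxvol A.
Proof.
move=> r0; rewrite -lee_pdivrMl ?exprn_gt0//.
rewrite [leRHS]/boxvol; apply: le_ereal_inf_tmp => _ [[-> ->]|[u [v [uv [-> ->]]]]].
  by rewrite preimage_set0 boxvol0 mule0.
rewrite lee_pdivrMl ?exprn_gt0//.
pose s (w : V) : V := [tuple (r * tnth w i + tnth c i)%R | i < N].
apply: ereal_inf_lbound; right; exists (s u), (s v); split.
  by move=> i; rewrite !tnth_mktuple lerD2r ler_pM2l.
split.
  apply/seteqP; split => x H i; have := H i; rewrite !tnth_mktuple.
    by rewrite ler_pdivlMr// ltr_pdivrMr// lerBrDr ltrBlDr !(mulrC r).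
  by rewrite ler_pdivlMr// ltr_pdivrMr// lerBrDr ltrBlDr !(mulrC r).
rewrite -EFinM -[in (r ^+ N)%R](card_ord N) -prodr_const -big_split/=.
congr EFin; apply: eq_bigr => i _; rewrite !tnth_mktuple; ring.
Qed.

Lemma leb_outer_affine (r : R) c A : (0 < r)%R ->
  lam (affine r c @^-1` A) <= (r ^+ N)%:E * lam A.
Proof.
move=> r0; rewrite -lee_pdivrMl ?exprn_gt0//.
rewrite -[leRHS]/(mu_ext (@boxvol R N) A); apply: le_ereal_inf_tmp => _ [F [mF AF] <-].
rewrite lee_pdivrMl ?exprn_gt0// -nneseriesZl; last by move=> *; exact: boxvol_ge0.
apply: (@le_trans _ _ (\sum_(k <oo) boxvol (affine r c @^-1` F k))).
  apply: ereal_inf_lbound; exists (fun k => affine r c @^-1` F k) => //; split.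
    by move=> k; rewrite -[X in measurable X]setTI; exact: measurable_affine.
  by rewrite -preimage_bigcup; exact: preimage_subset.
by apply: lee_nneseries => k *; [exact: boxvol_ge0|exact: boxvol_affine].
Qed.

Lemma enormZ (r : R) c x : (0 < r)%R -> enorm (affine r c x) = (enorm (tsub x c) / r)%R.
Proof.
move=> r0; rewrite /enorm -[X in (_ / X)%R](ger0_norm (ltW r0)) -sqrtr_sqr.
rewrite -sqrtrV ?sqr_ge0// -sqrtrM; last by apply: sumr_ge0 => i _; exact: sqr_ge0.
rewrite mulr_suml; congr Num.sqrt; apply: eq_bigr => i _.
by rewrite !tnth_mktuple expr_div_n.
Qed.

Lemma enorm_ge0 x : (0 <= enorm x)%R.
Proof. exact: sqrtr_ge0. Qed.

Lemma sqr_enorm x : (enorm x ^+ 2 = \sum_(i < N) tnth x i ^+ 2)%R.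
Proof. by rewrite sqr_sqrtr// sumr_ge0// => i _; exact: sqr_ge0. Qed.

Lemma enorm_eq0 x i : enorm x = 0%R -> tnth x i = 0%R.
Proof.
move=> x0; have := sqr_enorm x; rewrite x0 expr0n/= => /esym/eqP.
rewrite psumr_eq0 => [|j _]; last exact: sqr_ge0.
by move=> /allP/(_ i); rewrite mem_index_enum/= sqrf_eq0 => /(_ isT)/eqP.
Qed.

Lemma cauchy_schwarz x y :
  (\sum_(i < N) tnth x i * tnth y i <= enorm x * enorm y)%R.
Proof.
have [x0|x0] := eqVneq (enorm x) 0%R.
  by rewrite x0 mul0r big1// => i _; rewrite enorm_eq0// mul0r.
have [y0|y0] := eqVneq (enorm y) 0%R.
  by rewrite y0 mulr0 big1// => i _; rewrite (@enorm_eq0 y)// mulr0.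
have xp : (0 < enorm x)%R by rewrite lt_neqAle eq_sym x0 enorm_ge0.
have yp : (0 < enorm y)%R by rewrite lt_neqAle eq_sym y0 enorm_ge0.
(* Multiplied by [2 * (enorm x * enorm y)], the claim is the sum over [i] of the expanded
   inequalities [0 <= (enorm y * x_i - enorm x * y_i)^2]. *)
rewrite -(ler_pM2l (x := 2 * (enorm x * enorm y))%R) ?mulr_gt0//.
have -> : (2 * (enorm x * enorm y) * (enorm x * enorm y) =
  enorm y ^+ 2 * \sum_(i < N) tnth x i ^+ 2 + enorm x ^+ 2 * \sum_(i < N) tnth y i ^+ 2)%R.
  by rewrite -!sqr_enorm; ring.
rewrite !mulr_sumr -big_split/=; apply: ler_sum => i _.
have := sqr_ge0 (enorm y * tnth x i - enorm x * tnth y i)%R; lra.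
Qed.

Lemma ler_enormD x y :
  (enorm [tuple tnth x i + tnth y i | i < N] <= enorm x + enorm y)%R.
Proof.
rewrite -(@ler_pXn2r _ 2)// ?nnegrE ?addr_ge0 ?enorm_ge0//.
rewrite sqr_enorm sqrrD !sqr_enorm.
under eq_bigr do rewrite tnth_mktuple sqrrD.
rewrite !big_split/= lerD2r lerD2l.
by rewrite mulr2n lerD// cauchy_schwarz.
Qed.

Local Notation unit_volume := (lam [set x | enorm x <= 1]%R).

Lemma unit_volume_fin_num : unit_volume \is a fin_num.
Proof.
rewrite ge0_fin_numE ?(outer_measure_ge0 lam)//.
(* The boxes are half-open, so the upper corner has to lie strictly beyond 1. *)
pose u : V := [tuple (-1)%R | _ < N]; pose v : V := [tuple 2%R | _ < N].
have mb : measurable (box u v).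
  rewrite (_ : box u v = \bigcap_(i in [set: 'I_N]) ((fun x : V => tnth x i) @^-1`
      `[tnth u i, tnth v i[%classic)).
    apply: fin_bigcap_measurable; first exact: finite_finset.
    by move=> i _; apply: measurable_tnth_preimage; exact: measurable_itv.
  by apply/seteqP; split => x H i; have := H i; rewrite /= in_itv/=; [|apply].
apply: (@le_lt_trans _ _ (boxvol (box u v))).
  apply: ereal_inf_lbound; exists (fun n => if n is 0%N then box u v else set0).
    split; first by case.
    move=> x /= x1; exists 0%N => // i; rewrite !tnth_mktuple.
    have : (`|tnth x i| <= 1)%R.
      rewrite -(@ler_pXn2r _ 2)// ?nnegrE// expr1n real_normK ?num_real//.
      apply: (@le_trans _ _ (enorm x ^+ 2)%R); last by rewrite expr_le1 ?enorm_ge0.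
      rewrite sqr_enorm (bigD1 i)//= lerDl sumr_ge0// => j _; exact: sqr_ge0.
    rewrite ler_norml => /andP[->] /le_lt_trans; apply.
    by rewrite ltr1n.
  rewrite nneseries_recl; [|by case=> *; rewrite ?boxvol0 ?boxvol_ge0|by []].
  by rewrite eseries0 ?adde0// => -[//|n] _ _; rewrite boxvol0.
apply: le_lt_trans (ltry _); apply: ereal_inf_lbound; right; exists u, v; split => //.
by move=> i; rewrite !tnth_mktuple; lra.
Qed.

Lemma cball_volume_le c (r : R) : (0 < r)%R ->
  lam (cball c r) <= (r ^+ N)%:E * unit_volume.
Proof.
move=> r0; apply: le_trans (leb_outer_affine c _ r0).
apply: (le_outer_measure lam) => x /=.
by rewrite enormZ// ler_pdivrMr// mul1r.
Qed.

(** The scaling bound [leb_outer_affine] is only an inequality; used with [r^-1] in place of [r], it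
    gives this reverse estimate. *)
Lemma ball_volume_ge (r : R) : (0 < r)%R ->
  (r ^+ N)%:E * unit_volume <= lam [set x | enorm x <= r]%R.
Proof.
move=> r0; rewrite -lee_pdivlMl ?exprn_gt0// -exprVn.
have r0' : (0 < r^-1)%R by rewrite invr_gt0.
pose z : V := [tuple 0%R | _ < N].
apply: le_trans (leb_outer_affine z _ r0').
apply: (le_outer_measure lam) => x /= x1.
rewrite enormZ// invrK (_ : tsub x z = x) ?ler_piMl// ?ltW//.
by apply: eq_from_tnth => i; rewrite !tnth_mktuple subr0.
Qed.

Lemma enc_radius_le A B : A `<=` B -> enc_radius A <= enc_radius B.
Proof.
move=> AB; apply: ereal_inf_le_tmp => _ [r [r0 [c Bc]] <-].
by exists r => //; split => //; exists c; exact: subset_trans Bc.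
Qed.

Lemma enc_radius_ge0 A : 0 <= enc_radius A.
Proof. by apply: le_ereal_inf_tmp => _ [r [r0 _] <-]; rewrite lee_fin. Qed.

Lemma enc_radius_lt A (r : R) : enc_radius A < r%:E ->
  exists2 s, (0 <= s < r)%R & exists c, A `<=` cball c s.
Proof.
move=> /ereal_inf_lt[_ [s [s0 [c Ac]] <-]]; rewrite lte_fin => sr.
by exists s; [rewrite s0|exists c].
Qed.

(** The sum of two balls lies in a ball around the sum of the centres. The strict bounds provide
    actual enclosing balls, without attainment of the infimum in [enc_radius]. *)
Lemma minkowski_sum_volume F G (r s : R) : enc_radius F < r%:E -> enc_radius G < s%:E ->
  lam (minkowski_sum F G) <= ((r + s) ^+ N)%:E * unit_volume.
Proof.
move=> /enc_radius_lt[r' /andP[r'0 r'r] [c Fc]] /enc_radius_lt[s' /andP[s'0 s's] [d Gd]].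
have rs : (0 < r + s)%R by lra.
pose e : V := [tuple (tnth c i + tnth d i)%R | i < N].
apply: le_trans (cball_volume_le e rs).
apply: (le_outer_measure lam) => z [y /Fc /= zc /Gd /= yd].
rewrite /cball/= in zc yd *; rewrite (_ : tsub z e = [tuple tnth (tsub (tsub z y) c) i + tnth (tsub y d) i | i < N]%R).
  by apply: le_trans (ler_enormD _ _) _; lra.
by apply: eq_from_tnth => i; rewrite !tnth_mktuple; ring.
Qed.

End euclidean_geometry.

(** * Inequalities and one-sided limits for powers *)

Lemma exprD_le (R : realFieldType) (n : nat) (a b : R) : (0 <= a)%R -> (0 <= b)%R ->
  ((a + b) ^+ n.+1 <= 2 ^+ n * (a ^+ n.+1 + b ^+ n.+1))%R.
Proof.
move=> a0 b0; elim: n => [|n ih]; first by rewrite expr0 mul1r !expr1.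
rewrite exprS; apply: (@le_trans _ _ ((a + b) * (2 ^+ n * (a ^+ n.+1 + b ^+ n.+1)))%R).
  by rewrite ler_wpM2l// addr_ge0.
rewrite mulrCA [X in (_ <= X * _)%R]exprSr -mulrA ler_wpM2l ?exprn_ge0//.
(* Chebyshev's inequality: both differences have the same sign. Expanded, it bounds
   [(a + b) * (a ^+ n.+1 + b ^+ n.+1)] by twice [a ^+ n.+2 + b ^+ n.+2]. *)
have : (0 <= (a - b) * (a ^+ n.+1 - b ^+ n.+1))%R.
  have [ab|/ltW ab] := leP a b.
    by apply: mulr_le0; rewrite subr_le0//; apply: lerXn2r; rewrite ?nnegrE.
  by apply: mulr_ge0; rewrite subr_ge0//; apply: lerXn2r; rewrite ?nnegrE.
rewrite (exprS _ n.+1) (exprS b n.+1); lra.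
Qed.

(** Balls of radius [s < a] fill the open ball of radius [a]. At [a = 0] there is no such [s], and
    [0 < n] makes the left side vanish. *)
Lemma pow_left_limit (R : realType) (n : nat) (w a : R) (L : \bar R) :
  (0 < n)%N -> (0 <= a)%R -> 0 <= L ->
  (forall s, (0 < s < a)%R -> (s ^+ n * w)%:E <= L) -> (a ^+ n * w)%:E <= L.
Proof.
move=> n0 a0 L0 H; have [->|an0] := eqVneq a 0%R.
  by rewrite expr0n eqn0Ngt n0 mul0r.
have {an0}a0 : (0 < a)%R by rewrite lt_neqAle eq_sym an0.
case: L L0 H => [L||] // L0 H; last exact: leey.
have cv : (fun s : R => s ^+ n * w)%R @ a^'- --> (a ^+ n * w)%R.
  apply: cvg_at_left_filter; apply: cvgM; last exact: cvg_cst.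
  exact: exprn_continuous.
rewrite lee_fin; apply: (ler_cvg_to cv (cvg_cst L)).
near=> s; rewrite -lee_fin; apply: H; apply/andP; split.
  by near: s; exact: nbhs_left_gt.
by near: s; exact: nbhs_left_lt.
Unshelve. all: by end_near. Qed.

(** Removes the slack left by enclosing balls of radius slightly above the infimum. *)
Lemma pow_right_limit (R : realType) (n : nat) (w a : R) (L : \bar R) :
  (forall s, (a < s)%R -> L <= (s ^+ n * w)%:E) -> L <= (a ^+ n * w)%:E.
Proof.
case: L => [L||] H; last exact: leNye; last first.
  by have := H _ (ltr_pwDr ltr01 (lexx a)).
have cv : (fun s : R => s ^+ n * w)%R @ a^'+ --> (a ^+ n * w)%R.
  apply: cvg_at_right_filter; apply: cvgM; last exact: cvg_cst.
  exact: exprn_continuous.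
rewrite lee_fin; apply: (ler_cvg_to (cvg_cst L) cv).
near=> s; rewrite -lee_fin; apply: H.
by near: s; exact: nbhs_right_gt.
Unshelve. all: by end_near. Qed.

(** * Superlevel sets *)

Section level_sets.
Context (R : realType) (N : nat).
Local Notation V := (RN R N).
Local Notation lam := (@leb_outer R N).
Implicit Types (f g : V -> \bar R).

Lemma supmin_gt f g (xi : \bar R) :
  [set x | xi < supmin f g x] = minkowski_sum [set x | xi < f x] [set x | xi < g x].
Proof.
apply/seteqP; split => x /=.
  by move=> /ereal_sup_gt[_ [y _ <-]]; rewrite lt_min => /andP[]; exists y.
move=> [y /= xf xg]; apply: (@lt_le_trans _ _ (mine (f (tsub x y)) (g y))).
  by rewrite lt_min xf.
by apply: ereal_sup_ubound; exists y.
Qed.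

(** [rho_plus f] is nonincreasing, so a level below [xi'] with radius at most [enorm x] would
    contradict the second hypothesis. This only gives [xi' <= fhat f x]; the gap between [xi] and
    [xi'] makes the conclusion strict. *)
Lemma fhat_gt f (xi xi' : \bar R) x :
  xi < xi' -> (enorm x)%:E < rho_plus f xi' -> xi < fhat f x.
Proof.
move=> xx' xrho; apply: lt_le_trans xx' _.
apply: le_ereal_inf_tmp => eta /= eta_le; rewrite leNgt; apply/negP => etax.
move: xrho; rewrite ltNge; move/negP; apply; apply: le_trans eta_le.
by apply: enc_radius_le => y /=; exact: lt_trans.
Qed.

Lemma ball_volume_le_fhat f (xi xi' : \bar R) (r : R) : (0 < N)%N -> xi < xi' ->
  rho_plus f xi' = r%:E ->
  (r ^+ N * fine (lam [set x | enorm x <= 1]%R))%:E <= lam [set x | xi < fhat f x].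
Proof.
move=> N0 xx' rr.
have r0 : (0 <= r)%R by rewrite -lee_fin -rr enc_radius_ge0.
apply: pow_left_limit => //; first exact: (outer_measure_ge0 lam).
move=> s /andP[s0 sr]; rewrite EFinM fineK ?unit_volume_fin_num//.
apply: le_trans (ball_volume_ge N s0) _.
apply: (le_outer_measure lam) => x /= xs; apply: fhat_gt xx' _.
by rewrite rr lte_fin (le_lt_trans xs).
Qed.

Lemma supmin_level_lt f g (xi xi' : \bar R) : (0 < N)%N -> xi < xi' ->
  lam [set x | xi' < supmin f g x] <=
  (2 ^+ N.-1)%:R%:E * (lam [set x | xi < fhat f x] + lam [set x | xi < fhat g x]).
Proof.
move=> N0 xx'.
have C1 : 1 <= (2 ^+ N.-1)%:R%:E :> \bar R by rewrite lee_fin ler1n expn_gt0.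
have lam0 A : 0 <= lam A by exact: (outer_measure_ge0 lam).
(* An infinite enclosing radius at [xi'] makes the set where the hat function exceeds [xi] the whole
   space. *)
have full f' : rho_plus f' xi' = +oo -> lam [set x | xi' < supmin f g x] <=
    lam [set x | xi < fhat f' x].
  by move=> f'oo; apply: (le_outer_measure lam) => x _ /=; apply: fhat_gt xx' _;
    rewrite f'oo ltry.
have C0 : 0 <= (2 ^+ N.-1)%:R%:E :> \bar R by exact: le_trans C1.
have widen (L M : \bar R) : 0 <= L -> M <= L -> M <= (2 ^+ N.-1)%:R%:E * L.
  by move=> L0 /le_trans; apply; rewrite -[leLHS]mul1e lee_wpmul2r.
case Ef : (rho_plus f xi') (enc_radius_ge0 [set x | xi' < f x]) => [a||];
  rewrite -[enc_radius _]/(rho_plus f xi') Ef // => a0; last first.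
  apply: widen; first exact: adde_ge0.
  by apply: le_trans (full _ Ef) _; rewrite leeDl.
case Eg : (rho_plus g xi') (enc_radius_ge0 [set x | xi' < g x]) => [b||];
  rewrite -[enc_radius _]/(rho_plus g xi') Eg // => b0; last first.
  apply: widen; first exact: adde_ge0.
  by apply: le_trans (full _ Eg) _; rewrite leeDr.
pose w := fine (lam [set x | enorm x <= 1]%R).
have w0 : (0 <= w)%R by exact: fine_ge0.
apply: (@le_trans _ _ ((a + b) ^+ N * w)%:E).
  apply: pow_right_limit => s abs; rewrite supmin_gt EFinM fineK ?unit_volume_fin_num//.
  have -> : s = ((a + (s - (a + b)) / 2) + (b + (s - (a + b)) / 2))%R by field.
  apply: minkowski_sum_volume; rewrite -[enc_radius _]/(rho_plus _ xi').
    by rewrite Ef lte_fin; lra.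
  by rewrite Eg lte_fin; lra.
apply: (@le_trans _ _ ((2 ^+ N.-1)%:R%:E * ((a ^+ N * w)%:E + (b ^+ N * w)%:E))).
  rewrite -EFinD -EFinM lee_fin -mulrDl mulrA ler_wpM2r//.
  by rewrite -[in leLHS](prednK N0) -[X in (_ ^+ X + _ ^+ X)%R](prednK N0) natrX exprD_le.
by apply: lee_wpmul2l => //; apply: leeD; exact: ball_volume_le_fhat xx' _.
Qed.

Lemma supmin_level_le f g (xi : \bar R) : (0 < N)%N -> 0 <= xi ->
  lam [set x | xi < supmin f g x] <=
  (2 ^+ N.-1)%:R%:E * (lam [set x | xi < fhat f x] + lam [set x | xi < fhat g x]).
Proof.
move=> N0; case: xi => [r||] // _; last first.
  rewrite (_ : mkset _ = set0); last by apply/seteqP; split => x //=; rewrite ltNge leey.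
  rewrite (outer_measure0 lam) mule_ge0// ?lee_fin//.
  by rewrite adde_ge0// (outer_measure_ge0 lam).
(* The level set is the increasing union of those at [r + 1 / (n + 1)], where the estimate with a
   gap applies; continuity from below of the outer measure passes to the union. *)
have E : [set x | r%:E < supmin f g x] =
    \bigcup_n [set x | (r + n.+1%:R^-1)%:E < supmin f g x].
  apply/seteqP; split => x /=; last first.
    by move=> [n _] /=; apply: lt_trans; rewrite lte_fin ltrDl.
  move=> /ereal_dense[z rz zx]; case: z rz zx => [z||] //; last by move=> _; rewrite ltNge leey.
  rewrite lte_fin -subr_gt0 => zr zx.
  have [n _ /(_ n (leqnn n))/= nz] := near_infty_natSinv_lt (PosNum zr).
  by exists n => //=; apply: lt_trans zx; rewrite lte_fin -ltrBrDl.
rewrite leNgt; apply/negP; rewrite E => /(lt_outer_bigcup (@leb_outer_regular R N))[].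
  move=> n x /=; apply: le_lt_trans; rewrite lee_fin lerD2l lef_pV2 ?posrE ?ltr0n//.
  by rewrite ler_nat.
move=> n; rewrite ltNge => /negP; apply.
by apply: supmin_level_lt => //; rewrite lte_fin ltrDl.
Qed.

End level_sets.

(** * Comparing integrals through distribution functions *)

Section layer_cake.
Context {d : measure_display} (T : measurableType d) (R : realType).
Variable mu : {measure set T -> \bar R}.
Implicit Types u v w : T -> \bar R.

Lemma measurable_fun_gt u : (forall x, 0 <= u x) ->
  (forall t : R, (0 <= t)%R -> measurable [set x | t%:E < u x]) ->
  measurable_fun setT u.
Proof.
move=> u0 mu_gt.
apply: (measurability _ (ErealGenOInfty.measurableE R)) => _ [_ [r ->] <-].
rewrite setTI.
rewrite (_ : _ @^-1` _ = [set x | r%:E < u x]); last first.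
  by apply/seteqP; split => x /=; rewrite in_itv/= andbT.
have [r0|r0] := leP 0%R r; first exact: mu_gt.
rewrite (_ : mkset _ = setT) //; apply/seteqP; split => // x _ /=.
by apply: lt_le_trans (u0 x); rewrite lte_fin.
Qed.

(* Lower Riemann sum, with mesh 1 / (n + 1) on [0, n + 1], of the layer-cake
   integral of the indicator of t < a. *)
Definition staircase (n : nat) (a : \bar R) : R :=
  (\sum_(0 <= k < n.+1 ^ 2)
    (if (((k.+1)%:R / n.+1%:R)%:E < a)%E then n.+1%:R^-1 else 0))%R.

Lemma staircase_ge0 n a : (0 <= staircase n a)%R.
Proof. by apply: sumr_ge0 => k _; case: ifP. Qed.

Lemma staircase_le n a : 0 <= a -> (staircase n a)%:E <= a.
Proof.
move=> a0; pose s K : R := (\sum_(0 <= k < K)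
  (if (((k.+1)%:R / n.+1%:R)%:E < a)%E then n.+1%:R^-1 else 0))%R.
(* The two bounds go through the induction together: a step is taken only when
   [(K + 1) / (n + 1) < a], and it adds [1 / (n + 1)] to a sum of at most [K / (n + 1)]. *)
suff [] : (s (n.+1 ^ 2)%N)%:E <= a /\ (s (n.+1 ^ 2)%N <= (n.+1 ^ 2)%:R / n.+1%:R)%R by [].
elim: (n.+1 ^ 2)%N => [|K [ih1 ih2]]; first by rewrite /s big_nil mul0r.
have le : (K%:R / n.+1%:R + n.+1%:R^-1 = K.+1%:R / n.+1%:R :> R)%R.
  by rewrite -[in RHS]natr1 mulrDl mul1r.
rewrite /s big_nat_recr//= -/(s K); case: ifPn => [Ka|_]; last first.
  by rewrite addr0 -le ler_wpDr.
split; last by rewrite -le lerD2r.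
by apply: le_trans (ltW Ka); rewrite lee_fin -le lerD2r.
Qed.

Lemma staircase_ge (z : R) a : (0 <= z)%R -> z%:E < a ->
  \forall n \near \oo, (z <= staircase n a)%R.
Proof.
move=> z0 /ereal_dense[z' zz' z'a].
have [y zy ya] : exists2 y : R, (z < y)%R & y%:E < a.
  case: z' zz' z'a => [y||] //; first by rewrite lte_fin => zy ya; exists y.
  by move=> _; rewrite ltNge leey.
near=> n.
have nd : (n.+1%:R^-1 < y - z)%R.
  by near: n; apply: (near_infty_natSinv_lt (PosNum _)); rewrite subr_gt0.
have nz : (z <= n%:R)%R by near: n; exact: nbhs_infty_ger.
have n0 : (0 < n.+1%:R :> R)%R by rewrite ltr0n.
(* The first [m] terms are all nonzero, since their grid points are at most
   [z + 1 / (n + 1) < y < a], and they add up to [m / (n + 1) > z]. *)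
pose m := (Num.truncn (z * n.+1%:R)).+1.
have zn0 : (0 <= z * n.+1%:R)%R by rewrite mulr_ge0.
have /andP[m1 m2] : ((Num.truncn (z * n.+1%:R))%:R <= z * n.+1%:R < m%:R)%R.
  by rewrite truncn_itv.
have mK : (m <= n.+1 ^ 2)%N.
  rewrite -(ler_nat R) /m -natr1 natrX.
  have : (z * n.+1%:R <= n%:R * n.+1%:R)%R by rewrite ler_pM2r.
  have : (1 <= n.+1%:R :> R)%R by rewrite ler1n.
  have -> : (n%:R * n.+1%:R = n.+1%:R ^+ 2 - n.+1%:R :> R)%R.
    by rewrite -(natr1 n); ring.
  lra.
rewrite /staircase (big_cat_nat (n := m))//=.
apply: (@le_trans _ _ (\sum_(0 <= k < m) n.+1%:R^-1)%R).
  rewrite sumr_const_nat subn0 -[leRHS]mulr_natl.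
  by rewrite ler_pdivlMr// ltW.
rewrite ler_wpDr//; first by apply: sumr_ge0 => k _; case: ifP.
rewrite le_eqVlt; apply/orP; left; apply/eqP.
apply: eq_big_nat => k /andP[_ km]; rewrite ifT//.
apply: le_lt_trans ya; rewrite lee_fin.
apply: (@le_trans _ _ (m%:R / n.+1%:R)%R).
  by rewrite ler_pM2r ?invr_gt0// ler_nat.
rewrite /m -natr1 mulrDl mul1r -[leRHS](subrKC z) lerD//; last exact: ltW.
by rewrite ler_pdivrMr.
Unshelve. all: by end_near. Qed.

Lemma measurable_fun_levelset u (a : \bar R) :
  measurable_fun setT u -> measurable [set x | a < u x].
Proof. by move=> mf; rewrite -[X in measurable X]setTI; exact: emeasurable_fun_o_infty. Qed.

Lemma staircaseE n u x : (staircase n (u x))%:E =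
  \sum_(0 <= k < n.+1 ^ 2) (n.+1%:R^-1)%:E *
    (\1_[set x | (((k.+1)%:R / n.+1%:R)%:E < u x)%E] x)%:E.
Proof.
rewrite /staircase -sumEFin; apply: eq_bigr => k _.
rewrite indicE; case: ifPn => h; first by rewrite mem_set// mule1.
by rewrite memNset ?mule0//; exact/negP.
Qed.

Lemma measurable_staircase n u : measurable_fun setT u ->
  measurable_fun setT (fun x => (staircase n (u x))%:E).
Proof.
move=> mf; under eq_fun do rewrite staircaseE.
apply: emeasurable_sum => k; apply: measurable_funeM.
by apply/measurable_EFinP/measurable_indic/measurable_fun_levelset.
Qed.

Lemma integral_staircase n u : measurable_fun setT u ->
  \int[mu]_x (staircase n (u x))%:E =
  \sum_(0 <= k < n.+1 ^ 2) (n.+1%:R^-1)%:E *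
    mu [set x | ((k.+1)%:R / n.+1%:R)%:E < u x].
Proof.
move=> mf; under eq_integral do rewrite staircaseE.
have mi k : measurable_fun setT (fun x => (\1_[set x | (((k.+1)%:R / n.+1%:R)%:E < u x)%E] x : R)%:E).
  by apply/measurable_EFinP/measurable_indic/measurable_fun_levelset.
rewrite ge0_integral_sum//; last by move=> k; exact: measurable_funeM.
apply: eq_bigr => k _; rewrite ge0_integralZl//.
by rewrite integral_indic ?setIT//; exact: measurable_fun_levelset.
Qed.

(** Integrals of staircases are finite combinations of measures of superlevel sets, so the
    hypothesis carries over term by term; Fatou's lemma then passes to the functions. *)
Lemma ge0_le_integral_levels u v w (C : R) : (0 <= C)%R ->
  (forall x, 0 <= u x) -> (forall x, 0 <= v x) -> (forall x, 0 <= w x) ->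
  measurable_fun setT u -> measurable_fun setT v -> measurable_fun setT w ->
  (forall t : R, (0 <= t)%R -> mu [set x | t%:E < u x] <=
    C%:E * (mu [set x | t%:E < v x] + mu [set x | t%:E < w x])) ->
  \int[mu]_x u x <= C%:E * (\int[mu]_x v x + \int[mu]_x w x).
Proof.
move=> C0 u0 v0 w0 mu_ mv mw H.
have stair n : \int[mu]_x (staircase n (u x))%:E <=
    C%:E * (\int[mu]_x v x + \int[mu]_x w x).
  apply: (@le_trans _ _ (C%:E * (\int[mu]_x (staircase n (v x))%:E +
      \int[mu]_x (staircase n (w x))%:E))).
    rewrite !integral_staircase// -big_split/= ge0_sume_distrr; last first.
      by move=> k _; rewrite adde_ge0// mule_ge0// lee_fin.
    apply: lee_sum => k _; rewrite -muleDr ?ge0_adde_def ?inE// muleCA.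
    by apply: lee_wpmul2l; [rewrite lee_fin|apply: H; rewrite divr_ge0].
  apply: lee_wpmul2l; first by rewrite lee_fin.
  by apply: leeD; apply: ge0_le_integral => //; try exact: measurable_staircase;
    move=> x _; rewrite ?lee_fin ?staircase_ge0 ?staircase_le.
(* The staircases need not increase with [n], hence a lower limit and Fatou rather than monotone
   convergence. *)
rewrite (_ : \int[mu]_x u x = \int[mu]_x limn_einf (fun n => (staircase n (u x))%:E)).
  apply: le_trans (fatou _ _ _ _) _ => //.
  - by move=> n; exact: measurable_staircase.
  - by move=> n x _; rewrite lee_fin staircase_ge0.
  rewrite limn_einf_lim; apply: lime_le; first exact: is_cvg_einfs.
  apply: nearW => n; apply: le_trans (stair n).
  by apply: ereal_inf_lbound; exists n => /=.
apply: eq_integral => x _; apply/eqP; rewrite eq_le; apply/andP; split; last first.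
  rewrite limn_einf_lim; apply: lime_le; first exact: is_cvg_einfs.
  apply: nearW => n; apply: le_trans (staircase_le n (u0 x)).
  by apply: ereal_inf_lbound; exists n => /=.
rewrite limn_einf_lim leNgt; apply/negP => /ereal_dense[z].
have L0 : 0 <= limn (einfs (fun n => (staircase n (u x))%:E)).
  apply: lime_ge; first exact: is_cvg_einfs.
  by apply: nearW => n; apply: le_ereal_inf_tmp => _ [m _ <-]; rewrite lee_fin staircase_ge0.
move=> Lz zu; move: (lt_trans (le_lt_trans L0 Lz) zu) => _.
case: z Lz zu => [z||] Lz zu; last 2 first.
- by move: zu; rewrite ltNge leey.
- by move: Lz; rewrite ltNge leNye.
have z0 : (0 <= z)%R by rewrite -lee_fin ltW// (le_lt_trans L0).
have [n _ nz] := staircase_ge z0 zu.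
move: Lz; rewrite ltNge => /negP; apply.
apply: lime_ge; first exact: is_cvg_einfs.
exists n => // m /= nm; apply: le_ereal_inf_tmp => _ [k /= mk <-].
by rewrite lee_fin; apply: nz => /=; exact: leq_trans mk.
Qed.

End layer_cake.

(** * Young functions and their superlevel rays *)

Section young.
Context (R : realType) (phi : \bar R -> \bar R).
Hypothesis yphi : young phi.

Lemma young0 : phi 0 = 0. Proof. by case: yphi => -[]. Qed.

Lemma young_ge0 t : 0 <= t -> 0 <= phi t. Proof. by case: yphi => -[_ + _]; apply. Qed.

Lemma young_le s t : 0 <= s -> s <= t -> phi s <= phi t.
Proof. by case: yphi => _ [_ + _ _]; apply. Qed.

Lemma young_scale (l : R) (a : \bar R) : (0 < l < 1)%R -> 0 <= a ->
  phi (l%:E * a) <= l%:E * phi a.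
Proof.
move=> l01 a0; case: yphi => _ [_ _ cvx _].
by have := cvx a 0 l a0 (lexx 0) l01; rewrite !mule0 young0 !mule0 !adde0.
Qed.

(** The threshold is the supremum of the points where [phi] is at most [t]. If [t < phi u], left
    continuity, or the limit at infinity when [u = +oo], gives some [v < u] with [t < phi v], which
    keeps the supremum strictly below [u]. *)
Lemma young_level (t : R) : (0 <= t)%R ->
  exists2 s, 0 <= s & forall u, 0 <= u -> (t%:E < phi u) = (s < u).
Proof.
move=> t0; case: (yphi) => _ [_ _ _ [lcont ycont]].
pose S := [set v | 0 <= v /\ phi v <= t%:E].
have S0 : S 0 by split => //; rewrite young0 lee_fin.
have s0 : 0 <= ereal_sup S by exact: ereal_sup_ubound.
exists (ereal_sup S) => // u u0; apply/idP/idP => [tu|]; last first.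
  move=> su; rewrite ltNge; apply/negP => ut.
  by move: su; rewrite ltNge ereal_sup_ubound.
have nbhs_gt y : t%:E < y -> nbhs y [set z | t%:E < z].
  by move=> ty; apply: open_nbhs_nbhs; split => //; exact: open_ereal_gt_ereal.
have [v v0 [vu tv]] : exists2 v, 0 <= v & v < u /\ t%:E < phi v.
  case: u u0 tu => [u||] // u0 tu.
    have {}u0 : (0 < u)%R.
      rewrite lt_neqAle -lee_fin u0 andbT; apply/eqP => u00.
      by move: tu; rewrite -u00 young0 ltNge lee_fin t0.
    have : \forall s \near u^'-, t%:E < phi s%:E.
      exact: (lcont u u0 _ (nbhs_gt _ tu)).
    move=> H; near u^'- => v.
    exists v%:E; first by rewrite lee_fin ltW//; near: v; exact: nbhs_left_gt.
    by split; [rewrite lte_fin; near: v; exact: nbhs_left_lt|near: v].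
  have H : \forall s \near +oo%R, t%:E < phi s%:E.
    exact: (ycont _ (nbhs_gt _ tu)).
  near (pinfty_nbhs R) => v.
  exists v%:E; first by rewrite lee_fin; near: v; exact: nbhs_pinfty_ge.
  by split; [rewrite ltry|near: v].
apply: le_lt_trans vu; apply: ge_ereal_sup => x [x0 xt].
rewrite leNgt; apply/negP => vx.
by have := lt_le_trans tv (young_le v0 (ltW vx)); rewrite ltNge xt.
Unshelve. all: by end_near. Qed.

Lemma measurable_young_comp d (T : measurableType d) (h : T -> \bar R) :
  (forall x, 0 <= h x) -> (forall s, 0 <= s -> measurable [set x | s < h x]) ->
  measurable_fun setT (phi \o h).
Proof.
move=> h0 mh; apply: measurable_fun_gt => [x|t t0]; first exact: young_ge0.
have [s s0 Hs] := young_level t0.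
rewrite (_ : mkset _ = [set x | s < h x]); first exact: mh.
by apply/seteqP; split => x /=; rewrite Hs.
Qed.

End young.

(** * The Luxemburg norm *)

(** With [A], [B] and [S] the admissible radii of three Luxemburg norms, this turns a statement on
    radii into one on norms. An infinite infimum over [A] or [B] makes the right side infinite. *)
Lemma ereal_inf_le_scaled_sum (R : realType) (A B S : set R) (C : R) : (0 < C)%R ->
  A `<=` [set r | 0 <= r]%R -> B `<=` [set r | 0 <= r]%R ->
  (forall a b, A a -> B b -> S (C * (a + b))%R) ->
  ereal_inf [set r%:E | r in S] <=
    C%:E * (ereal_inf [set r%:E | r in A] + ereal_inf [set r%:E | r in B]).
Proof.
move=> C0 A0 B0 AB.
have inf0 (D : set R) : D `<=` [set r | 0 <= r]%R -> 0 <= ereal_inf [set r%:E | r in D].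
  by move=> D0; apply: le_ereal_inf_tmp => _ [r Dr <-]; rewrite lee_fin; exact: D0.
have adh (D : set R) (d x : R) : (0 < d)%R -> ereal_inf [set r%:E | r in D] = x%:E ->
    exists2 r, D r & (r < x + d)%R.
  move=> d0 Dx; have fin : ereal_inf [set r%:E | r in D] \is a fin_num by rewrite Dx.
  have [_ [r Dr <-]] := lb_ereal_inf_adherent d0 fin.
  by rewrite Dx -EFinD lte_fin => rx; exists r.
case Ea : (ereal_inf [set r%:E | r in A]) (inf0 _ A0) => [x||] // x0; last first.
  rewrite addye ?gt0_muley ?leey ?lte_fin//.
  by rewrite -ltNye (lt_le_trans _ (inf0 _ B0)).
case Eb : (ereal_inf [set r%:E | r in B]) (inf0 _ B0) => [y||] // y0; last first.
  by rewrite addey// gt0_muley ?leey ?lte_fin.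
apply/lee_addgt0Pr => e e0.
(* Two errors of this size, multiplied by [C], add up to [e]. *)
have d0 : (0 < e / (2 * C))%R by rewrite divr_gt0// mulr_gt0.
have [a Aa ax] := adh _ _ _ d0 Ea; have [b Bb bY] := adh _ _ _ d0 Eb.
apply: (@le_trans _ _ (C * (a + b))%:E).
  by apply: ereal_inf_lbound; exists (C * (a + b))%R => //; exact: AB.
rewrite -(EFinD x) -(EFinM C) -(EFinD _ e) lee_fin.
have -> : (C * (x + y) + e = C * ((x + e / (2 * C)) + (y + e / (2 * C))))%R.
  by field; rewrite gt_eqF.
by rewrite ler_pM2l// lerD// ltW.
Qed.

Lemma ge0_integral_le_scale d (T : measurableType d) (R : realType)
    (mu : {measure set T -> \bar R}) (u v : T -> \bar R) (l : R) : (0 <= l)%R ->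
  (forall x, 0 <= u x) -> (forall x, 0 <= v x) ->
  measurable_fun setT u -> measurable_fun setT v ->
  (forall x, u x <= l%:E * v x) ->
  \int[mu]_x u x <= l%:E * \int[mu]_x v x.
Proof.
move=> l0 u0 v0 mu_ mv uv; rewrite -ge0_integralZl//.
by apply: ge0_le_integral => //; exact: measurable_funeM.
Qed.

Section luxemburg_norm.
Context (R : realType) (N : nat).
Local Notation V := (RN R N).
Local Notation lam := (@leb_outer R N).
Implicit Types f g : V -> \bar R.

Lemma lebesgue_measurable_borel (A : set V) :
  measurable A -> measurable (A : set (LebRN R N)).
Proof. exact: borel_caratheodory. Qed.

Lemma measurable_enorm : measurable_fun setT (@enorm R N).
Proof.
apply: measurableT_comp; first by apply: continuous_measurable_fun; exact: sqrt_continuous.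
apply: measurable_sum => i; apply: measurable_funX; exact: measurable_tnth.
Qed.

Lemma gamma_plus_le f (s t : R) : (s <= t)%R -> gamma_plus f t <= gamma_plus f s.
Proof.
move=> st; apply: ereal_inf_le_tmp => xi /= /le_trans; apply.
by rewrite lee_fin.
Qed.

(** [gamma_plus f] is monotone, so its superlevel sets are intervals, and [fhat f] is its
    composition with the Borel function [enorm]. *)
Lemma measurable_fhat f :
  measurable_fun setT (fhat f : LebRN R N -> \bar R).
Proof.
apply: (measurability _ (ErealGenOInfty.measurableE R)) => _ [_ [r ->] <-].
rewrite setTI; apply: lebesgue_measurable_borel.
rewrite (_ : _ @^-1` _ = @enorm R N @^-1` [set t | r%:E < gamma_plus f t]); last first.
  by apply/seteqP; split => x /=; rewrite in_itv/= andbT.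
rewrite -[X in measurable X]setTI; apply: measurable_enorm => //.
apply: is_interval_measurable => s t /= rs rt u /andP[su ut].
by apply: lt_le_trans rt _; exact: gamma_plus_le.
Qed.

Lemma measurable_supmin_level f g (s : \bar R) :
  measurable_fun setT f -> measurable_fun setT g ->
  measurable ([set x | s < supmin f g x] : set (LebRN R N)).
Proof.
move=> mf mg; rewrite supmin_gt.
by apply: borel_sum_caratheodory; exact: measurable_fun_levelset.
Qed.

Lemma supmin_ge0 f g x : (forall x, 0 <= f x) -> (forall x, 0 <= g x) ->
  0 <= supmin f g x.
Proof.
move=> f0 g0; apply: (@le_trans _ _ (mine (f (tsub x x)) (g x))).
  by rewrite le_min f0 g0.
by apply: ereal_sup_ubound; exists x.
Qed.

Variable phi : \bar R -> \bar R.
Hypothesis yphi : young phi.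

Definition modular (r : R) (h : V -> \bar R) : \bar R :=
  \int[@lebN R N]_(x in [set: LebRN R N]) phi (r^-1%:E * `|h x|).

Lemma scale_ge0 (r : R) (a : \bar R) : (0 < r)%R -> 0 <= r^-1%:E * `|a|.
Proof. by move=> r0; rewrite mule_ge0// lee_fin invr_ge0 ltW. Qed.

Lemma measurable_modular (r : R) (h : LebRN R N -> \bar R) : (0 < r)%R ->
  (forall s, 0 <= s -> measurable [set x | s < `|h x|]) ->
  measurable_fun setT (fun x => phi (r^-1%:E * `|h x|)).
Proof.
move=> r0 mh; apply: (measurable_young_comp yphi) => [x|s s0]; first exact: scale_ge0.
rewrite (_ : mkset _ = [set x | r%:E * s < `|h x|]).
  by apply: mh; rewrite mule_ge0// lee_fin ltW.
by apply/seteqP; split => x /=; rewrite lte_pdivlMl.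
Qed.

Lemma measurable_fhat_level f (s : \bar R) :
  measurable ([set x | s < `|fhat f x|] : set (LebRN R N)).
Proof.
apply: (measurable_fun_levelset s).
by apply: measurableT_comp; [exact: abse_measurable|exact: measurable_fhat].
Qed.

Lemma modular_supmin_le f g (r : R) : (0 < N)%N -> (0 < r)%R ->
  (forall x, 0 <= f x) -> (forall x, 0 <= g x) ->
  measurable_fun setT f -> measurable_fun setT g ->
  modular r (supmin f g) <=
    (2 ^+ N.-1)%:R%:E * (modular r (fhat f) + modular r (fhat g)).
Proof.
move=> N0 r0 f0 g0 mf mg.
pose p h (x : LebRN R N) := phi (r^-1%:E * `|h x|).
have p0 h x : 0 <= p h x by exact/(young_ge0 yphi)/scale_ge0.
apply: (@ge0_le_integral_levels _ _ _ (@lebN R N) (p (supmin f g)) (p (fhat f))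
  (p (fhat g)) (2 ^+ N.-1)%:R%R).
- exact: ler0n.
- exact: p0.
- exact: p0.
- exact: p0.
- apply: measurable_modular => // s _.
  rewrite (_ : mkset _ = [set x | s < supmin f g x]); first exact: measurable_supmin_level.
  by apply/seteqP; split => x /=; rewrite gee0_abs// supmin_ge0.
- by apply: measurable_modular => // s _; exact: measurable_fhat_level.
- by apply: measurable_modular => // s _; exact: measurable_fhat_level.
move=> t t0; have [s s0 Hs] := young_level yphi t0.
have rs0 : 0 <= r%:E * s by rewrite mule_ge0// lee_fin ltW.
have E h : [set x | t%:E < phi (r^-1%:E * `|h x|)] = [set x : V | r%:E * s < `|h x|].
  by apply/seteqP; split => x /=; rewrite Hs ?scale_ge0// lte_pdivlMl.
rewrite !E (_ : [set x | _ < `|supmin f g x|] = [set x | r%:E * s < supmin f g x]); last first.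
  by apply/seteqP; split => x /=; rewrite gee0_abs// supmin_ge0.
apply: le_trans (supmin_level_le f g N0 rs0) _.
apply: lee_wpmul2l => //.
(* Absolute values on the right only enlarge the superlevel sets. *)
by apply: leeD; apply: (le_outer_measure lam) => x /= /lt_le_trans; apply; exact: lee_abs.
Qed.

(** The factor [r / s] lies strictly between 0 and 1, so convexity together with [phi 0 = 0] takes
    it out of [phi] pointwise. *)
Lemma modular_scale f (r s : R) : (0 < r < s)%R ->
  modular r (fhat f) <= 1 -> modular s (fhat f) <= (r / s)%:E.
Proof.
move=> /andP[r0 rs] f1; have s0 : (0 < s)%R by exact: lt_trans rs.
have rs0 : (0 < r / s)%R by rewrite divr_gt0.
apply: (@le_trans _ _ ((r / s)%:E * modular r (fhat f))); last first.
  by rewrite -[leRHS]mule1; apply: lee_wpmul2l => //; rewrite lee_fin ltW.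
pose p (t : R) (x : LebRN R N) := phi (t^-1%:E * `|fhat f x|).
have p0 (t : R) x : (0 < t)%R -> 0 <= p t x.
  by move=> t0; exact/(young_ge0 yphi)/scale_ge0.
have mp (t : R) : (0 < t)%R -> measurable_fun setT (p t).
  by move=> t0; apply: measurable_modular => // u _; exact: measurable_fhat_level.
apply: (@ge0_integral_le_scale _ _ _ (@lebN R N) (p s) (p r)).
- exact: ltW.
- by move=> x; exact: p0.
- by move=> x; exact: p0.
- exact: mp.
- exact: mp.
move=> x; rewrite /p (_ : s^-1%:E = (r / s)%:E * r^-1%:E); last first.
  by rewrite -EFinM; congr EFin; field; rewrite !gt_eqF.
rewrite -muleA; apply: (young_scale yphi); last exact: scale_ge0.
by rewrite rs0/= ltr_pdivrMr// mul1r.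
Qed.

Lemma lux_norm_supmin_le f g : (0 < N)%N ->
  (forall x, 0 <= f x) -> (forall x, 0 <= g x) ->
  measurable_fun setT f -> measurable_fun setT g ->
  lux_norm phi (supmin f g) <=
    (2 ^+ N.-1)%:R%:E * (lux_norm phi (fhat f) + lux_norm phi (fhat g)).
Proof.
move=> N0 f0 g0 mf mg; pose C : R := (2 ^+ N.-1)%:R%R.
have C1 : (1 <= C)%R by rewrite ler1n expn_gt0.
have C0 : (0 < C)%R by exact: lt_le_trans C1.
apply: (@ereal_inf_le_scaled_sum _
  [set r | (0 < r)%R /\ modular r (fhat f) <= 1]
  [set r | (0 < r)%R /\ modular r (fhat g) <= 1]
  [set r | (0 < r)%R /\ modular r (supmin f g) <= 1]) => //.
- by move=> r [/ltW].
- by move=> r [/ltW].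
move=> a b [a0 fa] [b0 gb].
(* For this radius the modular is at most [C * (a + b) / (C * (a + b)) = 1]. As [C >= 1] and [a],
   [b] are positive, it exceeds both, as [modular_scale] requires. *)
have r0 : (0 < C * (a + b))%R by rewrite mulr_gt0// addr_gt0.
have rab : (a + b <= C * (a + b))%R by rewrite ler_peMl// ltW// addr_gt0.
split => //.
apply: le_trans (modular_supmin_le N0 r0 f0 g0 mf mg) _.
apply: (@le_trans _ _ (C%:E * ((a / (C * (a + b)))%:E + (b / (C * (a + b)))%:E))).
  apply: lee_wpmul2l; first by rewrite lee_fin ltW.
  apply: leeD; apply: modular_scale => //; rewrite ?a0 ?b0/=.
    by apply: lt_le_trans rab; rewrite ltrDl.
  by apply: lt_le_trans rab; rewrite ltrDr.
rewrite -EFinD -EFinM lee_fin -mulrDl mulrA divff//.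
by rewrite gt_eqF.
Qed.

End luxemburg_norm.

Theorem theorem18 (R : realType) (N : nat) (hN : (0 < N)%N)
  (f g : RN R N -> \bar R) (phi : \bar R -> \bar R)
  (f_ge0 : forall x, 0 <= f x) (g_ge0 : forall x, 0 <= g x)
  (mf : measurable_fun [set: RN R N] f)
  (mg : measurable_fun [set: RN R N] g)
  (yphi : young phi) :
  [/\ measurable_fun [set: LebRN R N] (fun x : LebRN R N => phi (f x))
      /\ (forall x, 0 <= phi (f x)),
      measurable_fun [set: LebRN R N] (fun x : LebRN R N => phi (g x))
      /\ (forall x, 0 <= phi (g x)),
      measurable_fun [set: LebRN R N] (fun x : LebRN R N => phi (supmin f g x))
      /\ (forall x, 0 <= phi (supmin f g x))
    & lux_norm phi (supmin f g)
        <= (2 ^+ N.-1)%:R%:E * (lux_norm phi (fhat f) + lux_norm phi (fhat g))].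
Proof.
(* Superlevel sets of [phi] are rays, so measurability after composing with [phi] reduces to that of
   the sets where [h] exceeds a nonnegative level. *)
have level (h : RN R N -> \bar R) : measurable_fun setT h -> forall s : \bar R, 0 <= s ->
    measurable ([set x | s < h x] : set (LebRN R N)).
  move=> mh s _; apply: lebesgue_measurable_borel.
  exact: measurable_fun_levelset.
split.
- split => [|x]; last exact/(young_ge0 yphi).
  by apply: (measurable_young_comp yphi) => //; exact: level.
- split => [|x]; last exact/(young_ge0 yphi).
  by apply: (measurable_young_comp yphi) => //; exact: level.
- split => [|x]; last exact/(young_ge0 yphi)/supmin_ge0.
  apply: (measurable_young_comp yphi) => [x|s _]; first exact: supmin_ge0.
  exact: measurable_supmin_level.
- exact: lux_norm_supmin_le.
Qed.
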